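(* Let $n\in\mathbb N_0$, $q\in\mathbb C\setminus\{0\}$ with $|q|\ne1$, $z\in\mathbb C\setminus\{0\}$ and $x=\frac12(z+z^{-1})\neq0$. Fix a fourth root $q^{1/4}$ of $q$ and let all powers $q^{j/4}$, $j\in\mathbb Z$, be powers of it. Then the continuous $q^{-1}$-Hermite polynomial $H_n(x|q^{-1})$ satisfies $$H_n(x|q^{-1})=q^{-\frac{n^2}4}\,\frac{(q;q)_n}{(q^{\frac12};q^{\frac12})_n}\;{}_3\phi_1\left(q^{-\frac n2},\,q^{\frac14}z,\,q^{\frac14}z^{-1};\ -q^{\frac12};\ q^{\frac12},-q^{\frac n2}\right),$$ and, provided the denominators below do not vanish (i.e. $(q^{\frac14}z,q^{\frac14}z^{-1};q^{\frac12})_n\ne0$), $$H_n(x|q^{-1})=(-1)^nq^{-\frac{n^2}4}\,(q^{\frac14}z,q^{\frac14}z^{-1};q^{\frac12})_n\;{}_3\phi_2\left(q^{-\frac n2},\,-q^{-\frac n2},\,0;\ q^{\frac14-\frac n2}z,\,q^{\frac14-\frac n2}z^{-1};\ q^{\frac12},q^{\frac12}\right).$$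
   Context: $(a;q)_n=\prod_{j=0}^{n-1}(1-aq^j)$, $(a_1,\dots,a_k;q)_n=\prod_i(a_i;q)_n$, and $${}_r\phi_s(a_1,\dots,a_r;b_1,\dots,b_s;q,z)=\sum_{k\ge0}\frac{(a_1,\dots,a_r;q)_k}{(q,b_1,\dots,b_s;q)_k}\left((-1)^kq^{\binom k2}\right)^{1+s-r}z^k ,$$ where if a numerator parameter equals $q^{-n}$ ($q$ being the base of the series), $n\in\mathbb N_0$, the sum is over $0\le k\le n$. In the claim the base of the series is $q^{1/2}$. The continuous $q^{-1}$-Hermite polynomials are obtained from the continuous $q$-Hermite polynomials by $q\mapsto q^{-1}$; explicitly, for $x=\frac12(z+z^{-1})$, $H_n(x|q^{-1})=z^n\,{}_1\phi_1\left(q^{-n};0;q,q/z^2\right)$. *)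

(* Defs.v *)
From HB Require Import structures.
From mathcomp Require Import all_boot all_order all_algebra.
From mathcomp Require Import ring zify.
From mathcomp Require Import boolp classical_sets filter topology normedtype sequences.

Set Implicit Arguments.
Unset Strict Implicit.
Unset Printing Implicit Defensive.

Import Order.TTheory GRing.Theory Num.Theory.
Import numFieldNormedType.Exports.

Local Open Scope classical_set_scope.
Local Open Scope ring_scope.

Section BasicHypergeometric.
Variable C : numClosedFieldType.
Implicit Types (a q z x : C) (s num den : seq C) (n k : nat).

Definition qpoch a q n : C := \prod_(j < n) (1 - a * q ^+ j).

Definition qpochs s q n : C := \prod_(a <- s) qpoch a q n.

(* The exponent 1 + s - r may be negative, hence an integer power. *)
Definition qhyp_term num den q z k : C :=
  qpochs num q k / qpochs (q :: den) q k
  * ((-1) ^+ k * q ^+ 'C(k, 2)) ^ (1 + (size den)%:Z - (size num)%:Z)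
  * z ^+ k.

(* If several numerator parameters are of the form q^{-n}, the sum is cut at
   the least such n; the numerators of all later terms vanish anyway. *)
Definition qhyp num den q z : C :=
  match pselect (exists n, q ^- n \in num) with
  | left terminating =>
      \sum_(k < (ex_minn terminating).+1) qhyp_term num den q z k
  | right _ => limn (series (qhyp_term num den q z))
  end.

(* H_n(x | q^{-1}).  A solution z of x = (z + z^{-1}) / 2 is chosen; the other
   one is z^{-1}, and qinv_hermiteE shows that the choice is immaterial. *)
Definition qinv_hermite n q x : C :=
  let z := x + sqrtC (x ^+ 2 - 1) in
  z ^+ n * qhyp [:: q ^- n] [:: 0] q (q / z ^+ 2).

Lemma qpochSl a q n : qpoch a q n.+1 = (1 - a) * qpoch (a * q) q n.
Proof.
rewrite /qpoch big_ord_recl expr0 mulr1; congr (_ * _).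
by apply: eq_bigr => i _; rewrite /bump /= exprS mulrA.
Qed.

Lemma qpochSr a q n : qpoch a q n.+1 = qpoch a q n * (1 - a * q ^+ n).
Proof. by rewrite /qpoch big_ord_recr. Qed.

Lemma qpoch_neq0 q n : (forall k, (0 < k)%N -> q ^+ k != 1) -> qpoch q q n != 0.
Proof.
move=> hq; apply/prodf_neq0 => i _.
by rewrite subr_eq0 eq_sym -exprS hq.
Qed.

Lemma qpoch_expNr q k m : q != 0 ->
  qpoch (q ^- (m + k)) q k * qpoch q q m * (-1) ^+ k * q ^+ ('C(k, 2) + k + k * m)
  = qpoch q q (m + k).
Proof.
move=> q0; elim: k m => [|k IH] m.
  by rewrite addn0 {1}/qpoch big_ord0 mul1r !mulr1.
rewrite addnS [RHS]qpochSr -exprS -IH qpochSl.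
have -> : q ^- (m + k).+1 * q = q ^- (m + k).
  by rewrite exprSr invfM -mulrA mulVf ?mulr1.
have -> : ('C(k.+1, 2) + k.+1 + k.+1 * m
           = ('C(k, 2) + k + k * m) + (m + k).+1)%N.
  by rewrite binS bin1 mulSn; lia.
rewrite (exprD _ _ (m + k).+1) (exprS (-1)).
have : (1 - q ^- (m + k).+1) * q ^+ (m + k).+1 = q ^+ (m + k).+1 - 1.
  by rewrite mulrBl mul1r mulVf ?expf_neq0.
move: (q ^- (m + k).+1) => u; move: (q ^+ (m + k).+1) => v h.
move: (qpoch _ q k) => A; move: (qpoch q q m) => B.
move: (q ^+ (_ + _)) ((-1) ^+ k) => E S.
transitivity (- ((1 - u) * v) * A * B * S * E); first by ring.
by rewrite h; ring.
Qed.

Lemma expr_injective q : q != 0 -> (forall k, (0 < k)%N -> q ^+ k != 1) ->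
  injective (GRing.exp q).
Proof.
move=> q0 hq m n; wlog le_mn : m n / (m <= n)%N => [W e|e].
  by case/orP: (leq_total m n) => l; [apply: W | symmetry; apply: W].
case: (posnP (n - m)) => [|/hq]; first by lia.
by rewrite expfB_cond ?(negPf q0) // e divff ?eqxx ?expf_neq0.
Qed.

Lemma qhyp_hermiteE n q y : q != 0 -> (forall k, (0 < k)%N -> q ^+ k != 1) ->
  qhyp [:: q ^- n] [:: 0] q (q * y) =
  \sum_(k < n.+1) qpoch q q n / (qpoch q q k * qpoch q q (n - k))
                  * q ^- (k * (n - k)) * y ^+ k.
Proof.
move=> q0 hq; rewrite /qhyp; case: pselect => [t|]; last first.
  by case; exists n; rewrite inE.
have -> : ex_minn t = n.
  case: ex_minnP => m; rewrite inE => /eqP /invr_inj e _.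
  exact: expr_injective e.
apply: eq_bigr => -[k /= ltk] _; rewrite ltnS in ltk.
rewrite /qhyp_term /qpochs !big_cons !big_nil !mulr1 /=.
have -> : qpoch 0 q k = 1.
  by rewrite /qpoch big1 // => i _; rewrite mul0r subr0.
have -> : (1 + 1%:Z - 1%:Z) = 1 by [].
rewrite expr1z mulr1 exprMn.
have := qpoch_expNr k (n - k) q0; rewrite subnK // => <-.
rewrite 2!exprD.
have h1 := qpoch_neq0 k hq; have h2 := qpoch_neq0 (n - k) hq.
have h3 : q ^+ (k * (n - k)) != 0 by rewrite expf_neq0.
by field; rewrite h1 h2 h3.
Qed.

Lemma qinv_hermiteE n q z :
  q != 0 -> (forall k, (0 < k)%N -> q ^+ k != 1) -> z != 0 ->
  qinv_hermite n q ((z + z^-1) / 2)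
  = z ^+ n * qhyp [:: q ^- n] [:: 0] q (q / z ^+ 2).
Proof.
move=> q0 hq z0; rewrite /qinv_hermite.
set x := _ / 2; set w := x + _.
have : (w == z) || (w == z^-1).
  have e : (sqrtC (x ^+ 2 - 1)) ^+ 2 = ((z - z^-1) / 2) ^+ 2.
    by rewrite sqrtCK /x; field.
  move/eqP: e; rewrite eqf_sqr /w /x => /orP [] /eqP ->.
    by apply/orP; left; apply/eqP; field.
  by apply/orP; right; apply/eqP; field.
case/orP => /eqP -> //; rewrite !qhyp_hermiteE // !mulr_sumr.
rewrite (reindex_inj rev_ord_inj); apply: eq_bigr => -[k /= ltk] _.
rewrite subSS; rewrite ltnS in ltk; rewrite subKn //.
rewrite (mulnC (n - k)%N) (mulrC (qpoch q q (n - k))) mulrCA [RHS]mulrCA.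
congr (_ * _); have -> : z ^+ n = z ^+ (n - k) * z ^+ k by rewrite -exprD subnK.
rewrite -{1}(subnK ltk) exprD !exprVn invrK !(exprAC _ 2).
have h1 : z ^+ k != 0 by rewrite expf_neq0.
have h2 : z ^+ (n - k) != 0 by rewrite expf_neq0.
move: (z ^+ k) (z ^+ (n - k)) h1 h2 => u v h1 h2.
by field; rewrite h1 h2.
Qed.

End BasicHypergeometric.

(* Main.v *)
Require Import Defs.
From mathcomp Require Import all_boot all_order all_algebra.
From mathcomp Require Import complex reals.
From mathcomp Require Import ring zify boolp.

Import Order.TTheory GRing.Theory Num.Theory.
Local Open Scope ring_scope.

(** Write [q = p ^ 4] and [Q = p ^ 2], so that [Q] is the base of the series.
    By the finite form of the q-Hermite polynomial, [H_n(x | q^-1)] equals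
    [p^(-n^2) (q;q)_n] times

      [g_n = sum_k p^((n-2k)^2) z^(n-2k) / ((q;q)_k (q;q)_(n-k))].

    On the other side, [(Q;Q)_k (-Q;Q)_k = (q;q)_k], and rewriting
    [(Q^-n;Q)_k] through [(Q;Q)_(n-k)] turns the 3phi1 into [(Q;Q)_n h_n] with

      [h_n = sum_k (-1)^k (pz, p/z; Q)_k / ((q;q)_k (Q;Q)_(n-k))].

    The 3phi2 is the same sum read backwards, [k] becoming [n - k].  Both
    claims thus reduce to [g_n = h_n].

    That equality holds because both sequences start at 1 and satisfy

      [(1 - q^(n+1)) s_(n+1) = p^(2n+1) (z + 1/z) s_n + s_(n-1)],

    which is the three-term recurrence of the q^-1-Hermite polynomials after
    rescaling, and which determines a sequence since no power of [q] is 1.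
    Each recurrence is checked by splitting the factor [1 - q^(n+1)] inside
    the sum for [s_(n+1)] into pieces divisible by [1 - q^k] or by
    [1 - B^(n+1-k)], where [B] is the base of the factor indexed by [n+1-k];
    a factor of this kind cancels against the last factor of the denominator
    and shifts the index by one ([sum_lower_shift], [sum_upper_shift]), which
    leaves sums of the shape of [s_n] and [s_(n-1)]. *)

(** * Terminating series and q-shifted factorials *)

Lemma bin2_square (n : nat) : ('C(n, 2) + 'C(n, 2) + n = n * n)%N.
Proof. by elim: n => [|n IH] //; rewrite binS bin1; lia. Qed.

(** Another numerator parameter may be [q^-m] with [m < n], and then the series
    is cut earlier; this does not matter, since all terms beyond [m] contain
    the factor [1 - q^-m q^m]. *)
Lemma qhyp_terminating (C : numClosedFieldType) (num den : seq C) (q z : C)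
    (n : nat) :
  q != 0 -> q ^- n \in num ->
  qhyp num den q z = \sum_(k < n.+1) qhyp_term num den q z k.
Proof.
move=> q0 hn; rewrite /qhyp; case: pselect => [t|]; last by case; exists n.
case: ex_minnP => m hm /(_ n hn) le_mn.
rewrite (big_ord_widen n.+1 (qhyp_term num den q z)) // big_mkcond.
apply: eq_bigr => -[k /= _] _; case: ifP => // /negbT; rewrite -leqNgt => lt_mk.
suff e : qpochs num q k = 0 by rewrite /qhyp_term e !mul0r.
apply/eqP; rewrite /qpochs prodf_seq_eq0; apply/hasP; exists (q ^- m) => //=.
rewrite /qpoch prodf_seq_eq0; apply/hasP.
exists (Ordinal lt_mk); first by rewrite mem_index_enum.
by rewrite /= mulVf ?expf_neq0 // subrr.
Qed.

Lemma qpoch0 (C : numClosedFieldType) (a q : C) : qpoch a q 0 = 1.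
Proof. by rewrite /qpoch big_ord0. Qed.

Lemma qpoch0l (C : numClosedFieldType) (q : C) (n : nat) : qpoch 0 q n = 1.
Proof. by rewrite /qpoch big1 // => i _; rewrite mul0r subr0. Qed.

Lemma qpochs2 (C : numClosedFieldType) (a b q : C) (n : nat) :
  qpochs [:: a; b] q n = qpoch a q n * qpoch b q n.
Proof. by rewrite /qpochs !big_cons big_nil mulr1. Qed.

Lemma qpoch_sqr (C : numClosedFieldType) (a q : C) (n : nat) :
  qpoch a q n * qpoch (- a) q n = qpoch (a ^+ 2) (q ^+ 2) n.
Proof.
rewrite /qpoch -big_split; apply: eq_bigr => i _ /=.
by rewrite -exprM mulnC exprM; ring.
Qed.

(** The reversal [1 - a q^-(j+1) = - (a q^-(j+1)) (1 - b q^j)] for [a b = q],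
    taken over the top [k] factors of [(b;q)_(m+k)]. *)
Lemma qpoch_reverse {C : numClosedFieldType} {a b q : C} (m k : nat) :
  q != 0 -> a * b = q ->
  qpoch (a * q ^- (m + k)) q k * qpoch b q m
    * ((-1) ^+ k * b ^+ k * q ^+ ('C(k, 2) + k * m))
  = qpoch b q (m + k).
Proof.
move=> q0 ab; elim: k m => [|k IH] m.
  by rewrite addn0 qpoch0 mul1r !mulr1.
rewrite addnS [RHS]qpochSr -IH qpochSl.
have -> : a * q ^- (m + k).+1 * q = a * q ^- (m + k).
  by rewrite exprSr invfM -!mulrA mulVf ?mulr1.
have -> : ('C(k.+1, 2) + k.+1 * m = ('C(k, 2) + k * m) + (m + k))%N.
  by rewrite binS bin1 mulSn; lia.
rewrite (exprD _ _ (m + k)) !(exprS _ k).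
have : (1 - a * q ^- (m + k).+1) * (b * q ^+ (m + k)) = b * q ^+ (m + k) - 1.
  have h : q ^+ (m + k) != 0 by rewrite expf_neq0.
  rewrite exprS; move: h; move: (q ^+ (m + k)) => u h.
  have -> : (1 - a / (q * u)) * (b * u) = b * u - (a * b) / q by field; rewrite q0 h.
  by rewrite ab divff.
move: (1 - a * q ^- (m + k).+1) => w.
move: (qpoch _ q k) (qpoch b q m) ((-1) ^+ k) (b ^+ k) (q ^+ (_ + k * m)).
move: (q ^+ (m + k)) => v A B S U E h.
transitivity (- (w * (b * v)) * A * B * S * U * E); first by ring.
by rewrite h; ring.
Qed.

(** * Index shifts in convolution sums *)

(** The factor [1 - q^k] cancels the last factor of [(q;q)_k] and vanishes at
    [k = 0]: this realises the convention [1 / (q;q)_(-1) = 0] and lets the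
    recurrences below be proved without splitting off extreme indices. *)
Lemma sum_lower_shift (C : numClosedFieldType) (q : C) (X : nat -> C) (n : nat) :
  (forall k, (0 < k)%N -> q ^+ k != 1) ->
  \sum_(k < n.+2) (1 - q ^+ k) * (X k / qpoch q q k)
  = \sum_(k < n.+1) X k.+1 / qpoch q q k.
Proof.
move=> hq; rewrite big_ord_recl expr0 subrr mul0r add0r.
apply: eq_bigr => -[k /= _] _; rewrite /bump /= add1n.
have := qpoch_neq0 k.+1 hq; rewrite qpochSr -exprS mulf_eq0 negb_or.
by case/andP=> h1 h2; field; rewrite h1 h2.
Qed.

Lemma sum_upper_shift (C : numClosedFieldType) (q : C) (X : nat -> C) (n : nat) :
  (forall k, (0 < k)%N -> q ^+ k != 1) ->
  \sum_(k < n.+2) (1 - q ^+ (n.+1 - k)) * (X k / qpoch q q (n.+1 - k))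
  = \sum_(k < n.+1) X k / qpoch q q (n - k).
Proof.
move=> hq; rewrite big_ord_recr /= subnn expr0 subrr mul0r addr0.
apply: eq_bigr => -[k /= ltk] _; rewrite subSn //.
have := qpoch_neq0 (n - k).+1 hq; rewrite qpochSr -exprS mulf_eq0 negb_or.
by case/andP=> h1 h2; field; rewrite h1 h2.
Qed.

(** * The three-term recurrence *)

(** The recurrence of the q^-1-Hermite polynomials, for [H_n] multiplied by
    [p^(n^2) / (q;q)_n] with [q = p^4]; the scaling makes the coefficient of
    the last term equal to 1. The term of index -1 is 0. *)
Definition three_term {C : numClosedFieldType} (p c : C) (s : nat -> C) : Prop :=
  forall n, (1 - (p ^+ 4) ^+ n.+1) * s n.+1
            = p ^+ (2 * n).+1 * c * s n + (if n is m.+1 then s m else 0).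

Lemma three_term_unique (C : numClosedFieldType) (p c : C) (s t : nat -> C) :
  (forall k, (0 < k)%N -> (p ^+ 4) ^+ k != 1) ->
  three_term p c s -> three_term p c t -> s 0%N = t 0%N -> s =1 t.
Proof.
move=> hq hs ht h0 n.
suff [] : s n = t n /\ s n.+1 = t n.+1 by [].
have step m : s m = t m -> (if m is l.+1 then s l else 0) =
    (if m is l.+1 then t l else 0) -> s m.+1 = t m.+1.
  move=> e1 e2; have h : 1 - (p ^+ 4) ^+ m.+1 != 0 by rewrite subr_eq0 eq_sym hq.
  by apply: (mulfI h); rewrite hs ht e1 e2.
elim: n => [|n [IH1 IH2]]; first by split=> //; apply: step.
by split=> //; apply: step.
Qed.

(** This is [p^((l-k)^2) z^(l-k)], with the square expanded so that only natural
    exponents occur. *)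
Definition gauss_term {C : numClosedFieldType} (p z : C) (k l : nat) : C :=
  p ^+ (k ^ 2 + l ^ 2) / p ^+ (2 * k * l) * (z ^+ l / z ^+ k).

Definition hermite_sum {C : numClosedFieldType} (p z : C) (n : nat) : C :=
  \sum_(k < n.+1) gauss_term p z k (n - k)
    / qpoch (p ^+ 4) (p ^+ 4) k / qpoch (p ^+ 4) (p ^+ 4) (n - k).

Definition askey_wilson_sum {C : numClosedFieldType} (p z : C) (n : nat) : C :=
  \sum_(k < n.+1) (-1) ^+ k * qpochs [:: p * z; p * z^-1] (p ^+ 2) k
    / qpoch (p ^+ 4) (p ^+ 4) k / qpoch (p ^+ 2) (p ^+ 2) (n - k).

(** From [(l+1-k)^2 - (l-k)^2 = 2(l-k) + 1 = 2(k+l) + 1 - 4k]. *)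
Lemma gauss_termSr (C : numClosedFieldType) (p z : C) (k l : nat) :
  p != 0 -> (p ^+ 4) ^+ k * gauss_term p z k l.+1
            = p ^+ (2 * (k + l)).+1 * z * gauss_term p z k l.
Proof.
move=> p0; rewrite /gauss_term.
have -> : (k ^ 2 + l.+1 ^ 2 = (k ^ 2 + l ^ 2) + l + l + 1)%N by lia.
have -> : (2 * k * l.+1 = 2 * k * l + k + k)%N by lia.
have -> : ((2 * (k + l)).+1 = k + k + l + l + 1)%N by lia.
rewrite exprAC !exprD (exprS z).
have h1 : p ^+ k != 0 by rewrite expf_neq0.
have h2 : p ^+ (2 * k * l) != 0 by rewrite expf_neq0.
move: (p ^+ (2 * k * l)) h2 => u h2.
by move: (z ^+ k)^-1 => w; field; rewrite h1 h2.
Qed.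

Lemma gauss_termC (C : numClosedFieldType) (p z : C) (k l : nat) :
  gauss_term p z k l = gauss_term p z^-1 l k.
Proof.
by rewrite /gauss_term !exprVn invrK addnC mulnAC [z ^+ l / _]mulrC.
Qed.

Lemma gauss_termSl (C : numClosedFieldType) (p z : C) (k l : nat) :
  p != 0 -> (p ^+ 4) ^+ l * gauss_term p z k.+1 l
            = p ^+ (2 * (k + l)).+1 * z^-1 * gauss_term p z k l.
Proof. by move=> p0; rewrite !(gauss_termC _ p z) gauss_termSr // addnC. Qed.

Lemma gauss_termSS (C : numClosedFieldType) (p z : C) (k l : nat) :
  p != 0 -> z != 0 -> gauss_term p z k.+1 l.+1 = gauss_term p z k l.
Proof.
move=> p0 z0; rewrite /gauss_term.
have -> : (k.+1 ^ 2 + l.+1 ^ 2 = (k ^ 2 + l ^ 2) + 2 * (k + l + 1))%N by lia.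
have -> : (2 * k.+1 * l.+1 = 2 * k * l + 2 * (k + l + 1))%N by lia.
rewrite !(exprD p _ (2 * _)) !exprS.
have h1 : p ^+ (2 * (k + l + 1)) != 0 by rewrite expf_neq0.
have h2 : p ^+ (2 * k * l) != 0 by rewrite expf_neq0.
have h3 : z ^+ k != 0 by rewrite expf_neq0.
move: (p ^+ (2 * (k + l + 1))) (p ^+ (2 * k * l)) (z ^+ k) h1 h2 h3 => u v w h1 h2 h3.
by field; rewrite h1 h2 h3 z0.
Qed.

Lemma expr4_neq1 {C : numClosedFieldType} (p : C) :
  (forall k, (0 < k)%N -> (p ^+ 2) ^+ k != 1) ->
  forall k, (0 < k)%N -> (p ^+ 4) ^+ k != 1.
Proof.
move=> hQ k k0; have -> : (p ^+ 4) ^+ k = (p ^+ 2) ^+ (2 * k).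
  by rewrite -!exprM; congr (_ ^+ _); lia.
by rewrite hQ // muln_gt0 k0.
Qed.

(** With [l = n+1-k], the weight [1 - q^(k+l)] is split as
    [q^k (1 - q^l) + q^l (1 - q^k) + (1 - q^k)(1 - q^l)]. The first two parts
    give [p^(2n+1) z] and [p^(2n+1) / z] times the sum for [n], the last one the
    sum for [n - 1]. *)
Lemma hermite_sum_three_term (C : numClosedFieldType) (p z : C) :
  p != 0 -> z != 0 -> (forall k, (0 < k)%N -> (p ^+ 4) ^+ k != 1) ->
  three_term p (z + z^-1) (hermite_sum p z).
Proof.
move=> p0 z0 hq n; set q := p ^+ 4; pose E := gauss_term p z.
pose u k := qpoch q q k.
have -> : (1 - q ^+ n.+1) * hermite_sum p z n.+1
  = \sum_(k < n.+2) (1 - q ^+ (n.+1 - k))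
      * ((q ^+ k * E k (n.+1 - k)%N / u k) / u (n.+1 - k)%N)
  + \sum_(k < n.+2) (1 - q ^+ k)
      * ((q ^+ (n.+1 - k) * E k (n.+1 - k)%N / u (n.+1 - k)%N) / u k)
  + \sum_(k < n.+2) (1 - q ^+ k)
      * (((1 - q ^+ (n.+1 - k)) * E k (n.+1 - k)%N / u (n.+1 - k)%N) / u k).
  rewrite -!big_split mulr_sumr; apply: eq_bigr => -[k /= ltk] _.
  rewrite -[X in q ^+ X](@subnK k n.+1) -1?ltnS // exprD -/q -/(E _ _) -/(u _) -/(u _).
  by ring.
rewrite (sum_upper_shift _ _  (fun k => q ^+ k * E k (n.+1 - k)%N / u k)) //.
rewrite (sum_lower_shift _ _
  (fun k => q ^+ (n.+1 - k) * E k (n.+1 - k)%N / u (n.+1 - k)%N)) //.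
rewrite (sum_lower_shift _ _
  (fun k => (1 - q ^+ (n.+1 - k)) * E k (n.+1 - k)%N / u (n.+1 - k)%N)) //.
congr (_ + _).
  rewrite -big_split mulr_sumr; apply: eq_bigr => -[k /= ltk] _.
  rewrite subSS subSn // gauss_termSr // gauss_termSl // subnKC //.
  by rewrite -/q -/(u _) -/(u _) -/(E _ _); ring.
(* The rest is the term of index n - 1, zero for n = 0. *)
case: n => [|m]; first by rewrite big_ord1 subnn subrr !mul0r.
under eq_bigr => k _ do rewrite subSS.
transitivity (\sum_(k < m.+2) (1 - q ^+ (m.+1 - k))
   * ((E k.+1 (m.+1 - k)%N / u k) / qpoch q q (m.+1 - k))).
  by apply: eq_bigr => k _; rewrite -/(u _) -/(u _); ring.
rewrite (sum_upper_shift _ _  (fun k => E k.+1 (m.+1 - k)%N / u k)) //.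
by apply: eq_bigr => -[k /= ltk] _; rewrite subSn // /E gauss_termSS.
Qed.

(** Since [(1 - pz Q^k)(1 - (p/z) Q^k) = 1 - p (z + 1/z) Q^k + Q^(2k+1)],
    multiplying [(pz, p/z; Q)_k] by [z + 1/z] yields a combination of the terms
    of index [k] and [k + 1]. With [m = n - k] the recurrence then amounts to
    [1 - Q^(2n+2) = Q^m (1 + Q^(2k+1))(1 - Q^(m+1)) + Q^(m+1) (1 - Q^(2k))
    + (1 - Q^(m+1))(1 - Q^m)]. *)
Lemma askey_wilson_sum_three_term (C : numClosedFieldType) (p z : C) :
  p != 0 -> z != 0 -> (forall k, (0 < k)%N -> (p ^+ 2) ^+ k != 1) ->
  three_term p (z + z^-1) (askey_wilson_sum p z).
Proof.
move=> p0 z0 hQ n; set q := p ^+ 4; set Q := p ^+ 2.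
have qE k : q ^+ k = (Q ^+ k) ^+ 2.
  by rewrite /q /Q -!exprM; congr (_ ^+ _); lia.
have hq := expr4_neq1 p hQ : forall k, (0 < k)%N -> q ^+ k != 1.
pose A k := (-1) ^+ k * qpochs [:: p * z; p * z^-1] Q k.
pose u k := qpoch q q k; pose v k := qpoch Q Q k.
have AS k : (k <= n)%N -> p ^+ (2 * n).+1 * (z + z^-1) * A k
    = Q ^+ (n - k) * ((1 + Q * (Q ^+ k) ^+ 2) * A k + A k.+1).
  move=> lekn; rewrite /A !qpochs2 !qpochSr (exprS (-1)).
  have -> : p ^+ (2 * n).+1 = p * Q ^+ (n - k) * Q ^+ k.
    by rewrite -mulrA -exprD subnK // /Q -exprM exprS.
  rewrite /Q.
  by field.
have -> : (1 - q ^+ n.+1) * askey_wilson_sum p z n.+1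
  = \sum_(k < n.+2) (1 - Q ^+ (n.+1 - k))
      * ((Q ^+ (n - k) * (1 + Q * (Q ^+ k) ^+ 2) * A k / u k) / v (n.+1 - k)%N)
  + \sum_(k < n.+2) (1 - q ^+ k)
      * ((Q ^+ (n.+1 - k) * A k / v (n.+1 - k)%N) / u k)
  + \sum_(k < n.+2) (1 - Q ^+ (n.+1 - k))
      * (((1 - Q ^+ (n - k)) * A k / u k) / v (n.+1 - k)%N).
  rewrite -!big_split mulr_sumr; apply: eq_bigr => -[k /= ltk] _.
  rewrite -/q -/Q -/(u _) -/(v _) -/(A _).
  (* At k = n+1 the truncated n - k is 0, not -1; there 1 - Q^(n+1-k) = 0, so
     the two affected parts vanish all the same. *)
  move: ltk; rewrite ltnS leq_eqVlt => /orP [/eqP ->|ltk].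
    by rewrite subnn expr0; ring.
  have e : Q ^+ n = Q ^+ (n - k) * Q ^+ k by rewrite -exprD subnK.
  by rewrite subSn // !qE !(exprS Q) e; ring.
rewrite (sum_upper_shift _ _ 
  (fun k => Q ^+ (n - k) * (1 + Q * (Q ^+ k) ^+ 2) * A k / u k)) //.
rewrite (sum_lower_shift _ _
  (fun k => Q ^+ (n.+1 - k) * A k / v (n.+1 - k)%N)) //.
rewrite (sum_upper_shift _ _  (fun k => (1 - Q ^+ (n - k)) * A k / u k)) //.
congr (_ + _).
  rewrite -big_split mulr_sumr; apply: eq_bigr => -[k /= ltk] _.
  rewrite subSS -/q -/Q -/(u _) -/(v _) -/(A _).
  transitivity (p ^+ (2 * n).+1 * (z + z^-1) * A k / u k / v (n - k)%N).
    by rewrite AS //; ring.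
  by ring.
case: n {AS} => [|m]; first by rewrite big_ord1 subnn subrr !mul0r.
transitivity (\sum_(k < m.+2) (1 - Q ^+ (m.+1 - k))
   * ((A k / u k) / qpoch Q Q (m.+1 - k))).
  by apply: eq_bigr => k _; rewrite -/(u _) -/(v _); ring.
by rewrite (sum_upper_shift _ _  (fun k => A k / u k)).
Qed.

(** * The two expansions *)

(** The powers of [p] agree by [n^2 = (n-2k)^2 + 4k(n-k)]. *)
Lemma qinv_hermite_askey_wilson (C : numClosedFieldType) (n : nat) (p z : C) :
  p != 0 -> z != 0 -> (forall k, (0 < k)%N -> (p ^+ 2) ^+ k != 1) ->
  qinv_hermite n (p ^+ 4) ((z + z^-1) / 2)
  = p ^- (n ^ 2) * qpoch (p ^+ 4) (p ^+ 4) n * askey_wilson_sum p z n.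
Proof.
move=> p0 z0 hQ.
have hq := expr4_neq1 p hQ.
have q0 : p ^+ 4 != 0 by rewrite expf_neq0.
have <- : hermite_sum p z n = askey_wilson_sum p z n.
  apply: (three_term_unique _ p (z + z^-1)) => //.
  - exact: hermite_sum_three_term.
  - exact: askey_wilson_sum_three_term.
  rewrite /hermite_sum /askey_wilson_sum !big_ord1 subnn qpochs2 !qpoch0.
  by rewrite /gauss_term !expr0 !divr1 !mulr1.
rewrite qinv_hermiteE // qhyp_hermiteE // !mulr_sumr.
apply: eq_bigr => -[k /= ltk] _; rewrite ltnS in ltk; rewrite /gauss_term.
have -> : z ^+ n = z ^+ (n - k) * z ^+ k by rewrite -exprD subnK.
have -> : (n ^ 2 = (k ^ 2 + (n - k) ^ 2) + 2 * k * (n - k))%N.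
  by rewrite -{1}(subnK ltk); move: (n - k)%N => m; lia.
have -> : (p ^+ 4) ^+ (k * (n - k)) = (p ^+ (2 * k * (n - k))) ^+ 2.
  by rewrite -!exprM; congr (_ ^+ _); lia.
rewrite exprVn (exprAC z) (exprD p).
have h1 : z ^+ k != 0 by rewrite expf_neq0.
have h2 : p ^+ (2 * k * (n - k)) != 0 by rewrite expf_neq0.
have h3 : p ^+ (k ^ 2 + (n - k) ^ 2) != 0 by rewrite expf_neq0.
have h4 := qpoch_neq0 k hq; have h5 := qpoch_neq0 (n - k) hq.
move: (p ^+ (2 * k * (n - k))) (p ^+ (k ^ 2 + (n - k) ^ 2)) h2 h3 => a b h2 h3.
by field; rewrite h1 h2 h3 h4 h5.
Qed.

(** The factor [((-1)^k Q^'C(k,2))^-1] of the 3phi1 cancels against the power of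
    [Q] by which [(Q^-n;Q)_k] differs from [(Q;Q)_n / (Q;Q)_(n-k)]. *)
Lemma askey_wilson_sum_3phi1 {C : numClosedFieldType} (n : nat) (p z : C) :
  p != 0 -> (forall k, (0 < k)%N -> (p ^+ 2) ^+ k != 1) ->
  qpoch (p ^+ 2) (p ^+ 2) n * askey_wilson_sum p z n
  = qhyp [:: p ^- (2 * n); p * z; p * z^-1] [:: - p ^+ 2]
         (p ^+ 2) (- p ^+ (2 * n)).
Proof.
move=> p0 hQ; have hq := expr4_neq1 p hQ.
have Q0 : p ^+ 2 != 0 by rewrite expf_neq0.
rewrite (@qhyp_terminating _ _ _ _ _ n) //; last by rewrite -exprM inE eqxx.
rewrite mulr_sumr; apply: eq_bigr => -[k /= ltk] _; rewrite ltnS in ltk.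
rewrite /qhyp_term qpochs2 /qpochs !big_cons !big_nil !mulr1 /=.
have eqQ : (p ^+ 2) ^+ 2 = p ^+ 4 by rewrite -exprM.
rewrite qpoch_sqr (exprM p 2 n) eqQ.
have -> : (1 + 1%:Z - 3%:Z) = -1 by [].
rewrite exprN1 (exprNn ((p ^+ 2) ^+ n)).
have := qpoch_expNr k (n - k) Q0; rewrite subnK // => e.
(* 'C(k, 2) + k + k(n - k) = nk - 'C(k, 2) *)
have eC : ((p ^+ 2) ^+ n) ^+ k
    = (p ^+ 2) ^+ ('C(k, 2) + k + k * (n - k)) * (p ^+ 2) ^+ 'C(k, 2).
  rewrite -!exprM -exprD; congr (_ ^+ _).
  have := bin2_square k; have := subnK ltk; move: (n - k)%N => m <-; nia.
rewrite eC -e.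
have h2 : (p ^+ 2) ^+ 'C(k, 2) != 0 by rewrite !expf_neq0.
have h3 := qpoch_neq0 k hq; have h4 := qpoch_neq0 (n - k) hQ.
by rewrite invfM invr_sign; field; rewrite h2 h3 h4.
Qed.

(** Reversal of the order of summation: as [pz * (p/z) = Q], the denominators
    [(p Q^-n z;Q)_k] and [(p Q^-n / z;Q)_k] are up to powers the quotients of
    [(p/z;Q)_n] by [(p/z;Q)_(n-k)] and of [(pz;Q)_n] by [(pz;Q)_(n-k)]. *)
Lemma askey_wilson_sum_3phi2 {C : numClosedFieldType} (n : nat) (p z : C) :
  p != 0 -> z != 0 -> (forall k, (0 < k)%N -> (p ^+ 2) ^+ k != 1) ->
  qpochs [:: p * z; p * z^-1] (p ^+ 2) n != 0 ->
  qpoch (p ^+ 4) (p ^+ 4) n * askey_wilson_sum p z n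
  = (-1) ^+ n * qpochs [:: p * z; p * z^-1] (p ^+ 2) n
    * qhyp [:: p ^- (2 * n); - p ^- (2 * n); 0]
           [:: p ^ (1 - (2 * n)%:Z) * z; p ^ (1 - (2 * n)%:Z) * z^-1]
           (p ^+ 2) (p ^+ 2).
Proof.
move=> p0 z0 hQ hA; have hq := expr4_neq1 p hQ.
have Q0 : p ^+ 2 != 0 by rewrite expf_neq0.
have q0 : p ^+ 4 != 0 by rewrite expf_neq0.
have ab : (p * z) * (p * z^-1) = p ^+ 2 by field.
have ba : (p * z^-1) * (p * z) = p ^+ 2 by rewrite mulrC.
rewrite (@qhyp_terminating _ _ _ _ _ n) //; last by rewrite -exprM inE eqxx.
rewrite /askey_wilson_sum (reindex_inj rev_ord_inj) !mulr_sumr.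
apply: eq_bigr => -[k /= ltk] _; rewrite subSS ltnS in ltk *.
rewrite subKn // /qhyp_term /qpochs !big_cons !big_nil !mulr1 /=.
have eqQ : (p ^+ 2) ^+ 2 = p ^+ 4 by rewrite -exprM.
rewrite qpoch0l mulr1 qpoch_sqr eqQ.
have -> : (p ^- (2 * n)) ^+ 2 = (p ^+ 4) ^- n.
  by rewrite exprVn -!exprM; congr (_ ^- _); lia.
have shift w : p ^ (1 - (2 * n)%:Z) * w = p * w * (p ^+ 2) ^- n.
  by rewrite expfzDr // expr1z -exprnN exprM mulrAC.
rewrite !shift.
have := qpoch_expNr k (n - k) q0; rewrite subnK // => e.
have := qpoch_reverse (n - k) k Q0 ab; rewrite subnK // => e1.
have := qpoch_reverse (n - k) k Q0 ba; rewrite subnK // => e2.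
move: hA; rewrite !qpochs2 => hA.
have : qpoch (p * z) (p ^+ 2) n * qpoch (p * z^-1) (p ^+ 2) n != 0 by [].
rewrite -{1}e1 -{1}e2 !mulf_eq0 !negb_or.
move=> /andP [/andP [/andP [D2 _] _] /andP [/andP [D1 _] _]].
have h3 := qpoch_neq0 (n - k) hq; have h4 := qpoch_neq0 k hQ.
(* The sign (-1)^k and the power of Q occur twice, once for each factor; the
   k-th powers of pz and p/z combine to Q^k. *)
have eA : qpoch (p * z) (p ^+ 2) n * qpoch (p * z^-1) (p ^+ 2) n
    = qpoch (p * z * (p ^+ 2) ^- n) (p ^+ 2) k
      * qpoch (p * z^-1 * (p ^+ 2) ^- n) (p ^+ 2) k
      * (qpoch (p * z) (p ^+ 2) (n - k) * qpoch (p * z^-1) (p ^+ 2) (n - k))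
      * ((p ^+ 2) ^+ k * ((p ^+ 2) ^+ ('C(k, 2) + k * (n - k))) ^+ 2).
  have -> : (p ^+ 2) ^+ k = (p * z) ^+ k * (p * z^-1) ^+ k by rewrite -exprMn ab.
  by rewrite -e1 -e2 -[RHS](signrMK k); ring.
have eS : (-1) ^+ n = (-1) ^+ (n - k) * (-1) ^+ k :> C by rewrite -exprD subnK.
have eq4 : (p ^+ 4) ^+ ('C(k, 2) + k + k * (n - k))
    = ((p ^+ 2) ^+ k * (p ^+ 2) ^+ ('C(k, 2) + k * (n - k))) ^+ 2.
  by rewrite -exprD -!exprM; congr (_ ^+ _); lia.
rewrite eA eS -e eq4.
by field; rewrite D1 D2 h3 h4.
Qed.

Theorem theorem3p31 (R : realType) (n : nat) (q p z x : R[i])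
  (hq0 : q != 0) (hq1 : `|q| != 1) (hp : p ^+ 4 = q)
  (hz : z != 0) (hx : x = (z + z^-1) / 2) (hx0 : x != 0) :
  qinv_hermite n q x =
    p ^- (n ^ 2) * (qpoch q q n / qpoch (p ^+ 2) (p ^+ 2) n)
    * qhyp [:: p ^- (2 * n); p * z; p * z^-1] [:: - p ^+ 2]
           (p ^+ 2) (- p ^+ (2 * n))
  /\
  (qpochs [:: p * z; p * z^-1] (p ^+ 2) n != 0 ->
   qinv_hermite n q x =
    (-1) ^+ n * p ^- (n ^ 2) * qpochs [:: p * z; p * z^-1] (p ^+ 2) n
    * qhyp [:: p ^- (2 * n); - p ^- (2 * n); 0]
           [:: p ^ (1 - (2 * n)%:Z) * z; p ^ (1 - (2 * n)%:Z) * z^-1]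
           (p ^+ 2) (p ^+ 2)).
Proof.
have p0 : p != 0 by apply: contraNneq hq0 => e; rewrite -hp e expr0n.
have hQ k : (0 < k)%N -> (p ^+ 2) ^+ k != 1.
  move=> k0; apply: contraNneq hq1 => e.
  have : `|q| ^+ k = 1.
    by rewrite -normrX -hp exprAC (exprM _ 2 2) exprAC e expr1n normr1.
  by move/eqP; rewrite pexpr_eq1 // -lt0n.
rewrite hx -hp qinv_hermite_askey_wilson //; split=> [|hA].
  rewrite -askey_wilson_sum_3phi1 //.
  by rewrite !mulrA divfK ?qpoch_neq0.
rewrite -[LHS]mulrA askey_wilson_sum_3phi2 //.
by rewrite (mulrC ((-1) ^+ n) (p ^- _)) !mulrA.
Qed.
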